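(* Let $r,s \geq 0$ be integers. Then: (i) $\mathcal{D}_{r,s} = \mathcal{D}_{s,r}$. (ii) $\mathcal{D}_{0,s} = \mathbf{D}_s$. (iii) $\mathcal{D}_{1,s} = 2$ if $s=0$; $\mathcal{D}_{1,s}=3$ if $s=1$; $\mathcal{D}_{1,s}=\mathbf{D}_s$ if $s \geq 2$ is even; $\mathcal{D}_{1,s}=\mathbf{D}_{s+1}$ if $s \geq 3$ is odd. (iv) $2 \nmid \mathcal{D}_{r,s}$ whenever $r,s \geq 2$. (v) $3 \mid \mathcal{D}_{r,s}$ whenever $r,s \geq 1$. (vi) If $r \geq 2$ is even and $p \geq 3$ is a prime with $p-1 \mid r$, then $p \mid \mathcal{D}_{r,s}$. In particular, $\mathcal{D}_{r,s}$ is squarefree, and $\mathcal{D}_{r,s} = 1$ holds only in the cases $(r,s) = (0,0)$, $(r,s) = (n,0)$, and $(r,s) = (0,n)$ with $n \geq 3$ odd.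
   Context: The Bernoulli numbers $\mathbf{B}_n$ are defined by $\frac{t}{e^t-1} = \sum_{n \geq 0} \mathbf{B}_n \frac{t^n}{n!}$ (so $\mathbf{B}_1 = -\tfrac12$). For integers $r,s \geq 0$ define $\mathcal{B}_{r,s} = \sum_{\nu=0}^{r} \binom{r}{\nu} \mathbf{B}_{s+\nu}$. For a rational $q$, $\operatorname{denom}(q)$ is the smallest positive integer $d$ with $dq \in \mathbb{Z}$. Let $\mathcal{D}_{r,s} = \operatorname{denom}(\mathcal{B}_{r,s})$ and $\mathbf{D}_n = \operatorname{denom}(\mathbf{B}_n)$. *)

(* Defs.v *)
From mathcomp Require Import all_boot all_order all_algebra.

Set Implicit Arguments.
Unset Strict Implicit.
Unset Printing Implicit Defensive.

Import Order.TTheory GRing.Theory Num.Theory.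
Local Open Scope ring_scope.

(* A formal power series over rat is its coefficient sequence nat -> rat. *)
Definition fps_mul (f g : nat -> rat) (n : nat) : rat :=
  \sum_(i < n.+1) f i * g (n - i)%N.

(* The first n coefficients of f / g, where g 0 != 0. *)
Fixpoint fps_div_seq (f g : nat -> rat) (n : nat) : seq rat :=
  if n is m.+1 then
    let q := fps_div_seq f g m in
    rcons q ((f m - \sum_(i < m) q`_i * g (m - i)%N) / g 0%N)
  else [::].

Definition fps_div (f g : nat -> rat) (n : nat) : rat :=
  (fps_div_seq f g n.+1)`_n.

Definition fps_one (n : nat) : rat := (n == 0%N)%:R.
Definition fps_t (n : nat) : rat := (n == 1%N)%:R.
Definition fps_exp (n : nat) : rat := (n`!%:R)^-1.
Definition fps_expm1 (n : nat) : rat := fps_exp n - fps_one n.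

(* t / (e^t - 1) is computed as 1 / ((e^t - 1) / t), whose divisor has constant
   coefficient 1; bernoulli_gf and bernoulli_unique below give the link with
   the generating function itself. *)
Definition bernoulli (n : nat) : rat :=
  n`!%:R * fps_div fps_one (fun k => fps_expm1 k.+1) n.

Definition bernoulli_sum (r s : nat) : rat :=
  \sum_(nu < r.+1) 'C(r, nu)%:R * bernoulli (s + nu).

Definition denom (q : rat) : nat := `|denq q|%N.

Definition denom_bernoulli (n : nat) : nat := denom (bernoulli n).
Definition denom_bernoulli_sum (r s : nat) : nat := denom (bernoulli_sum r s).

Definition squarefree (n : nat) : Prop :=
  forall m : nat, (m ^ 2 %| n)%N -> m = 1%N.

Lemma denom_gt0 (q : rat) : (0 < denom q)%N.
Proof. by rewrite /denom absz_gt0 denq_neq0. Qed.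

Lemma denom_mul_int (q : rat) : (denom q)%:R * q \is a Num.int.
Proof.
have -> : (denom q)%:R = (denq q)%:~R :> rat by rewrite -[in RHS]absz_denq.
by rewrite mulrC -numqE intr_int.
Qed.

Lemma denom_min (q : rat) (d : nat) :
  (0 < d)%N -> d%:R * q \is a Num.int -> (denom q <= d)%N.
Proof.
move=> d_gt0 /intrP[z Ez]; apply: dvdn_leq => //.
have E : (d%:Z * numq q)%:~R = (z * denq q)%:~R :> rat.
  by rewrite !rmorphM /= numqE mulrA -pmulrn Ez.
move/intr_inj: E => /(congr1 absz); rewrite !abszM /= => E.
have : (`|denq q| %| d * `|numq q|)%N by rewrite E dvdn_mull.
by rewrite Gauss_dvdl // coprime_sym coprime_num_den.
Qed.

Lemma size_fps_div_seq (f g : nat -> rat) n : size (fps_div_seq f g n) = n.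
Proof. by elim: n => //= n IHn; rewrite size_rcons IHn. Qed.

Lemma nth_fps_div_seq (f g : nat -> rat) n i :
  (i < n)%N -> (fps_div_seq f g n)`_i = fps_div f g i.
Proof.
elim: n => // n IHn; rewrite ltnS leq_eqVlt => /orP[/eqP-> //|lt_in] /=.
by rewrite nth_rcons size_fps_div_seq lt_in IHn.
Qed.

Lemma fps_divK (f g : nat -> rat) :
  g 0%N != 0 -> fps_mul (fps_div f g) g =1 f.
Proof.
move=> g0 n; rewrite /fps_mul big_ord_recr /= subnn.
rewrite {2}/fps_div /= nth_rcons size_fps_div_seq ltnn eqxx divfK //.
under [X in _ - X]eq_bigr => i _ do rewrite nth_fps_div_seq //.
by rewrite addrC subrK.
Qed.

Lemma fps_mulC (f g : nat -> rat) : fps_mul f g =1 fps_mul g f.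
Proof.
move=> n; rewrite /fps_mul (reindex_inj rev_ord_inj) /=.
by apply: eq_bigr => i _; rewrite subSS subKn 1?mulrC // -ltnS.
Qed.

Lemma fps_expm1_0 : fps_expm1 0 = 0.
Proof. by rewrite /fps_expm1 /fps_exp /fps_one /= invr1 subrr. Qed.

Lemma bernoulli_gf :
  fps_mul fps_expm1 (fun n => bernoulli n / n`!%:R) =1 fps_t.
Proof.
move=> [|n]; rewrite /fps_mul; first by rewrite big_ord1 fps_expm1_0 mul0r.
rewrite big_ord_recl fps_expm1_0 mul0r add0r.
have g0 : fps_expm1 1%N != 0 by [].
rewrite /fps_t eqSS -[RHS](@fps_divK fps_one (fun k => fps_expm1 k.+1) g0 n).
rewrite fps_mulC /fps_mul; apply: eq_bigr => i _.
rewrite lift0 subSS /bernoulli [_ * fps_div _ _ _]mulrC mulfK //.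
by rewrite pnatr_eq0 -lt0n fact_gt0.
Qed.

Lemma bernoulli_unique (B : nat -> rat) :
  fps_mul fps_expm1 (fun n => B n / n`!%:R) =1 fps_t -> B =1 bernoulli.
Proof.
move=> gfB n; have [m] := ubnP n; elim: m n => // m IHm n; rewrite ltnS => le_nm.
have := etrans (gfB n.+1) (esym (bernoulli_gf n.+1)).
rewrite fps_mulC [in RHS]fps_mulC /fps_mul !big_ord_recr /= subnn subSnn.
rewrite fps_expm1_0 !mulr0 !addr0.
under eq_bigr => i _ do rewrite (IHm i (leq_trans (ltn_ord i) le_nm)).
have -> : fps_expm1 1%N = 1 by [].
rewrite !mulr1 => /addrI /mulIf; apply.
by rewrite invr_eq0 pnatr_eq0 -lt0n fact_gt0.
Qed.

(* Main.v *)
Require Import Defs.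
From HB Require Import structures.
From mathcomp Require Import all_boot all_order all_algebra all_solvable all_field.
From mathcomp Require Import ring lra zify.

(* Let L be the linear functional on polynomials with L(x^n) = B_n; then
   B_{r,s} = L(x^s (x + 1)^r), and L(f(x + 1)) = L(f) + f'(0).  Hence also
   L(f(-x - 1)) = L(f), which gives B_{r,s} = (-1)^{r+s} B_{s,r}.  Summing the
   difference equation over a < p and arguing p-adically as in the proof of the
   von Staudt-Clausen theorem, p B_n is p-integral for every prime p, and for
   odd p one gets p B_{r,s} = \sum_{a < p} a^s (a + 1)^r modulo p, so p divides
   the denominator exactly when this power sum is nonzero in F_p. *)

(** * Bernoulli numbers as moments of a linear functional *)

Section UmbralCalculus.

Import Order.TTheory GRing.Theory Num.Theory.
Local Open Scope ring_scope.

Definition umbral (B : nat -> rat) (f : {poly rat}) : rat :=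
  \sum_(i < size f) f`_i * B i.

(** Coefficients past the size vanish, so polynomials of different sizes can be compared over one
    index range. *)
Lemma umbral_widen (B : nat -> rat) (n : nat) (f : {poly rat}) :
  (size f <= n)%N -> umbral B f = \sum_(i < n) f`_i * B i.
Proof.
move=> le_fn; rewrite /umbral (big_ord_widen n (fun i => f`_i * B i) le_fn).
rewrite big_mkcond; apply: eq_bigr => i _.
by case: ltnP => // /(nth_default 0) ->; rewrite mul0r.
Qed.

Fact umbral_is_linear (B : nat -> rat) : linear_for *%R (umbral B).
Proof.
move=> a f g; set n := maxn (size f) (size g).
have le_n : (size (a *: f + g)%R <= n)%N.
  by rewrite (leq_trans (size_polyD _ _)) // geq_max leq_maxr andbT
             (leq_trans (size_scale_leq _ _)) ?leq_maxl.
rewrite (umbral_widen _ _ _ le_n) (umbral_widen _ n f) ?leq_maxl //.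
rewrite (umbral_widen _ n g) ?leq_maxr // mulr_sumr -big_split /=.
by apply: eq_bigr => i _; rewrite coefD coefZ mulrDl mulrA.
Qed.
HB.instance Definition _ (B : nat -> rat) :=
  GRing.isLinear.Build rat {poly rat} rat *%R (umbral B) (umbral_is_linear B).

Lemma umbralZ (B : nat -> rat) (a : rat) (f : {poly rat}) :
  umbral B (a *: f) = a * umbral B f.
Proof. exact: linearZ. Qed.

Lemma umbralXn (B : nat -> rat) (n : nat) : umbral B 'X^n = B n.
Proof.
rewrite /umbral size_polyXn big_ord_recr /= coefXn eqxx mul1r big1 ?add0r //.
by move=> i _; rewrite coefXn ltn_eqF // mul0r.
Qed.

Lemma umbral_XDn (B : nat -> rat) (c : rat) (n : nat) :
  umbral B (('X + c%:P) ^+ n) =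
  \sum_(i < n.+1) 'C(n, i)%:R * c ^+ i * B (n - i)%N.
Proof.
rewrite exprDn raddf_sum; apply: eq_bigr => i _ /=.
by rewrite -scaler_nat umbralZ -polyC_exp [_ * _%:P]mulrC mul_polyC umbralZ
           umbralXn mulrA.
Qed.

Lemma umbral_XD1n (B : nat -> rat) (n : nat) :
  umbral B (('X + 1) ^+ n) = \sum_(i < n.+1) 'C(n, i)%:R * B i.
Proof.
rewrite addrC exprDn raddf_sum; apply: eq_bigr => i _ /=.
by rewrite expr1n mul1r -scaler_nat umbralZ umbralXn.
Qed.

(** Since [e^t - 1] has no constant term, the index [n] drops out; this turns the generating
    function into a binomial recurrence. *)
Lemma fps_mul_expm1 (B : nat -> rat) (n : nat) :
  n`!%:R * fps_mul fps_expm1 (fun k => B k / k`!%:R) n =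
  \sum_(j < n) 'C(n, j)%:R * B j.
Proof.
have fact_neq0 k : k`!%:R != 0 :> rat by rewrite pnatr_eq0 -lt0n fact_gt0.
rewrite fps_mulC /fps_mul big_ord_recr /= subnn fps_expm1_0 mulr0 addr0.
rewrite mulr_sumr; apply: eq_bigr => j _.
have lt_jn := ltn_ord j.
rewrite /fps_expm1 /fps_one /fps_exp subn_eq0 leqNgt lt_jn subr0.
rewrite -(bin_fact (ltnW lt_jn)) !natrM; field.
by rewrite !fact_neq0.
Qed.

Lemma bernoulli_rec (n : nat) :
  \sum_(j < n) 'C(n, j)%:R * bernoulli j = (n == 1%N)%:R.
Proof.
rewrite -fps_mul_expm1 bernoulli_gf /fps_t.
by case: eqP => [->|]; rewrite ?mulr0 ?mulr1.
Qed.

Lemma bernoulli0 : bernoulli 0 = 1.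
Proof. by have := bernoulli_rec 1; rewrite big_ord1 mul1r. Qed.

Lemma bernoulli1 : bernoulli 1 = - 2^-1.
Proof.
have := bernoulli_rec 2; rewrite !big_ord_recr big_ord0 /= bernoulli0 bin0 bin1.
by move=> E; lra.
Qed.

Lemma bernoulli2 : bernoulli 2 = 6^-1.
Proof.
have := bernoulli_rec 3; rewrite !big_ord_recr big_ord0 /= bernoulli0 bernoulli1.
by rewrite -[in 'C(_, 2)]bin_sub // bin0 !bin1 => E; lra.
Qed.

Lemma umbral_bernoulli_XD1n (n : nat) :
  umbral bernoulli (('X + 1) ^+ n) = bernoulli n + (n == 1%N)%:R.
Proof.
by rewrite umbral_XD1n big_ord_recr /= binn mul1r bernoulli_rec addrC.
Qed.

(* The sequence on the left satisfies the recurrence characterising the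
   Bernoulli numbers. *)
Lemma bernoulli_reflect (n : nat) :
  (-1) ^+ n * umbral bernoulli (('X + 1) ^+ n) = bernoulli n.
Proof.
pose M n : rat := (-1) ^+ n * umbral bernoulli (('X + 1) ^+ n).
suff /bernoulli_unique : fps_mul fps_expm1 (fun k => M k / k`!%:R) =1 fps_t.
  by move/(_ n).
move=> m; have fact_neq0 : m`!%:R != 0 :> rat by rewrite pnatr_eq0 -lt0n fact_gt0.
apply: (mulfI fact_neq0); rewrite fps_mul_expm1 /fps_t.
have : \sum_(j < m.+1) 'C(m, j)%:R * M j = (-1) ^+ m * bernoulli m.
  (* This polynomial is [(-X) ^ m]; expanded in powers of [-(X + 1)] it yields the sum of the
     [M j]. *)
  transitivity (umbral bernoulli ((- ('X + 1) + 1) ^+ m)).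
    rewrite addrC exprDn raddf_sum; apply: eq_bigr => j _ /=.
    by rewrite expr1n mul1r -scaler_nat umbralZ -scaleN1r exprZn umbralZ.
  by rewrite opprD addrNK -scaleN1r exprZn umbralZ umbralXn.
(* The term [j = m] is [(-1) ^ m * (bernoulli m + (m == 1))]; cancelling its first half leaves the
   recurrence. *)
rewrite big_ord_recr /= binn mul1r {2}/M umbral_bernoulli_XD1n mulrDr.
move/(canRL (addrK _)) => ->; rewrite opprD addrA subrr sub0r.
by case: eqP => [->|_]; rewrite ?mulr0 ?oppr0 ?mulr1 ?opprK.
Qed.

Lemma umbral_bernoulli_reflect (f : {poly rat}) :
  umbral bernoulli (f \Po (- ('X + 1))) = umbral bernoulli f.
Proof.
rewrite -[f in RHS]coefK poly_def comp_polyE !raddf_sum; apply: eq_bigr => i _ /=.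
by rewrite !umbralZ -scaleN1r exprZn umbralZ bernoulli_reflect umbralXn.
Qed.

Lemma bernoulli_sum_umbral (r s : nat) :
  bernoulli_sum r s = umbral bernoulli ('X^s * ('X + 1) ^+ r).
Proof.
rewrite addrC exprDn mulr_sumr raddf_sum; apply: eq_bigr => i _ /=.
by rewrite expr1n mul1r mulrnAr -exprD -scaler_nat umbralZ umbralXn.
Qed.

(** Substituting [-(X + 1)] for [X] exchanges the factors [X] and [X + 1], each up to a sign. *)
Lemma bernoulli_sumC (r s : nat) :
  bernoulli_sum r s = (-1) ^+ (r + s) * bernoulli_sum s r.
Proof.
rewrite !bernoulli_sum_umbral -umbral_bernoulli_reflect -umbralZ; congr umbral.
rewrite rmorphM !rmorphXn rmorphD rmorph1 /= comp_polyX.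
rewrite opprD addrNK -opprD -!(scaleN1r (_ : {poly rat})) !exprZn.
by rewrite -scalerAl -scalerAr scalerA -exprD addnC mulrC.
Qed.

(** Reflection and the difference equation together give [bernoulli n = - bernoulli n]. *)
Lemma bernoulli_odd (n : nat) : odd n -> (1 < n)%N -> bernoulli n = 0.
Proof.
move=> odd_n n_gt1; have := bernoulli_reflect n.
rewrite umbral_bernoulli_XD1n -signr_odd odd_n (gtn_eqF n_gt1) addr0 mulN1r.
by move/eqP; rewrite eq_sym -addr_eq0 -mulr2n mulrn_eq0 => /eqP.
Qed.

(** Among monomials only [X] changes its value under the shift, by 1, so the correction is the
    coefficient of [X] in [f]. *)
Lemma umbral_bernoulli_shift (f : {poly rat}) :
  umbral bernoulli (f \Po ('X + 1)) = umbral bernoulli f + f^`().[0].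
Proof.
rewrite comp_polyE raddf_sum /=.
under eq_bigr => i _ do rewrite umbralZ umbral_bernoulli_XD1n mulrDr.
rewrite big_split; congr (_ + _) => //; rewrite horner_coef0 coef_deriv mulr1n.
have [lt1f|le1f] := ltnP 1 (size f).
  rewrite (bigD1 (Ordinal lt1f)) //= mulr1 big1 ?addr0 // => i.
  by rewrite -val_eqE /= => /negbTE->; rewrite mulr0.
rewrite nth_default // big1 // => i _.
by rewrite ltn_eqF ?mulr0 // (leq_trans (ltn_ord i)).
Qed.

(* Telescoping [(X + a + 1) ^ (n + 1) - (X + a) ^ (n + 1)] over [a < p]. *)
Lemma umbral_bernoulli_XDn (n p : nat) :
  umbral bernoulli (('X + p%:R%:P) ^+ n.+1) =
  bernoulli n.+1 + n.+1%:R * \sum_(a < p) a%:R ^+ n.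
Proof.
elim: p => [|p IHp]; first by rewrite polyC0 addr0 umbralXn big_ord0 mulr0 addr0.
have -> : 'X + p.+1%:R%:P = ('X + p%:R%:P) \Po ('X + 1) :> {poly rat}.
  by rewrite rmorphD /= comp_polyX comp_polyC -addn1 natrD polyCD addrAC addrA.
rewrite -rmorphXn umbral_bernoulli_shift IHp deriv_exp derivD derivX derivC addr0.
rewrite big_ord_recr /= mulrDr addrA mul1r hornerMn horner_exp hornerD hornerX.
by rewrite hornerC add0r !mulr_natl.
Qed.

(** Expanding [(X + p) ^ (n + 1)] and comparing with the telescoped value cancels [bernoulli n.+1];
    the identity [(n + 1) C(n, k) = (k + 1) C(n + 1, k + 1)] then removes the factor [n + 1]. *)
Lemma bernoulli_power_sum (n p : nat) :
  \sum_(a < p) a%:R ^+ n =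
  \sum_(k < n.+1) 'C(n, k)%:R * bernoulli (n - k) * (p%:R ^+ k.+1 / k.+1%:R).
Proof.
have := umbral_bernoulli_XDn n p; rewrite umbral_XDn big_ord_recl.
rewrite bin0 expr0 !mul1r subn0 => /addrI/esym E.
have n1_neq0 : n.+1%:R != 0 :> rat by rewrite pnatr_eq0.
apply: (mulfI n1_neq0); rewrite E mulr_sumr; apply: eq_bigr => k _.
rewrite lift0 subSS; have := mul_bin_diag n.+1 k => /(congr1 (fun m => m%:R : rat)).
rewrite !natrM /= => Ek; have k1_neq0 : k.+1%:R != 0 :> rat by rewrite pnatr_eq0.
apply: (mulfI k1_neq0).
transitivity ((k.+1%:R * 'C(n.+1, k.+1)%:R) * p%:R ^+ k.+1 * bernoulli (n - k)).
  by rewrite !mulrA.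
rewrite -Ek; move: k1_neq0; move: (k.+1%:R) => c c_neq0.
by field.
Qed.

End UmbralCalculus.

(** * Integrality at a prime and von Staudt-Clausen congruences *)

Section LocalIntegers.

Import Order.TTheory GRing.Theory Num.Theory.
Local Open Scope ring_scope.

(* For [p] prime, the localisation of the integers at [p]. *)
Definition local_int (p : nat) : {pred rat} := [pred q | coprime p (denom q)].

Lemma denom_dvd (q : rat) (d : nat) :
  d%:R * q \is a Num.int -> (denom q %| d)%N.
Proof.
move=> /intrP[z Ez].
have E : (d%:Z * numq q)%:~R = (z * denq q)%:~R :> rat.
  by rewrite !rmorphM /= numqE mulrA -pmulrn Ez.
move/intr_inj: E => /(congr1 absz); rewrite !abszM /= => E.
have : (`|denq q| %| d * `|numq q|)%N by rewrite E dvdn_mull.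
by rewrite Gauss_dvdl // coprime_sym coprime_num_den.
Qed.

Lemma local_intI (p d : nat) (q : rat) :
  coprime p d -> d%:R * q \is a Num.int -> q \in local_int p.
Proof. by move=> cop /denom_dvd; rewrite inE => /coprime_dvdr; apply. Qed.

Fact local_int_subring (p : nat) : subring_closed (local_int p).
Proof.
split=> [|x y /[!inE] px py|x y /[!inE] px py].
- by apply: (local_intI p 1); rewrite ?coprimen1 ?mulr1.
- apply: (local_intI p (denom x * denom y)); first by rewrite coprimeMr px.
  by rewrite natrM mulrBr {1}[_ * (denom y)%:R]mulrC -!mulrA rpredB // rpredM
             ?denom_mul_int // rpred_nat.
apply: (local_intI p (denom x * denom y)); first by rewrite coprimeMr px.
by rewrite natrM mulrACA rpredM ?denom_mul_int.
Qed.
HB.instance Definition _ (p : nat) :=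
  GRing.isSubringClosed.Build rat (local_int p) (local_int_subring p).

Lemma local_intN_dvd (p : nat) (q : rat) :
  prime p -> (p %| denom q)%N = (q \notin local_int p).
Proof. by move=> p_pr; rewrite inE prime_coprime // negbK. Qed.

Lemma nat_div_local_int (p n : nat) :
  prime p -> (n%:R / p%:R \in local_int p) = (p %| n)%N.
Proof.
move=> p_pr; have p_neq0 : p%:R != 0 :> rat by rewrite pnatr_eq0 -lt0n prime_gt0.
apply/idP/idP => [|/dvdnP[m ->]]; last by rewrite natrM mulfK // rpred_nat.
rewrite inE; set q := _ / _ => cop; have /intrP[z] := denom_mul_int q.
move/(congr1 ( *%R^~ p%:R)); rewrite /q -mulrA divfK // -natrM !pmulrn -intrM.
move/intr_inj/(congr1 absz); rewrite abszM /= => E.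
by rewrite -(Gauss_dvdr _ cop) E dvdn_mull.
Qed.

(** The part of [m] prime to [p] already clears the denominator. *)
Lemma local_int_expn_div (p e m : nat) :
  prime p -> (0 < m)%N -> (logn p m <= e)%N ->
  p%:R ^+ e / m%:R \in local_int p.
Proof.
move=> p_pr m_gt0 le_e; have [k cop Em] := pfactor_coprime p_pr m_gt0.
apply: (local_intI p k) => //.
have p_neq0 : p%:R != 0 :> rat by rewrite pnatr_eq0 -lt0n prime_gt0.
have k_neq0 : k%:R != 0 :> rat.
  by rewrite pnatr_eq0 -lt0n; move: m_gt0; rewrite Em muln_gt0 => /andP[].
rewrite Em natrM natrX invfM mulrCA mulVKf //.
by rewrite -expfB_cond ?(negbTE p_neq0) // -natrX rpred_nat.
Qed.

Lemma logn_leq_expn (p e m : nat) :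
  prime p -> (0 < m)%N -> (m < p ^ e.+1)%N -> (logn p m <= e)%N.
Proof.
move=> p_pr m_gt0 lt_m; rewrite -ltnS -(ltn_exp2l _ _ (prime_gt1 p_pr)).
by apply: leq_ltn_trans lt_m; rewrite dvdn_leq // pfactor_dvdnn.
Qed.

Lemma bernoulli_power_sum_recl (n p : nat) :
  p%:R * bernoulli n =
  \sum_(a < p) a%:R ^+ n -
  \sum_(k < n) 'C(n, k.+1)%:R * bernoulli (n - k.+1) *
               (p%:R ^+ k.+2 / k.+2%:R).
Proof.
rewrite bernoulli_power_sum big_ord_recl bin0 subn0 mul1r expr1 divr1.
by rewrite [bernoulli n * _]mulrC addrK.
Qed.

(** Strong induction on the power sum formula: one factor [p] goes to the earlier Bernoulli number,
    and [p ^ (k + 1) / (k + 2)] is [p]-integral because [k + 2 < p ^ (k + 2)]. *)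
Lemma mul_prime_bernoulli_local_int (p n : nat) :
  prime p -> p%:R * bernoulli n \in local_int p.
Proof.
move=> p_pr; have [m] := ubnP n; elim: m n => // m IHm n; rewrite ltnS => le_nm.
rewrite bernoulli_power_sum_recl rpredB ?rpred_sum // => [a _|k _].
  by rewrite rpredX ?rpred_nat.
have -> : 'C(n, k.+1)%:R * bernoulli (n - k.+1) * (p%:R ^+ k.+2 / k.+2%:R) =
  'C(n, k.+1)%:R * ((p%:R * bernoulli (n - k.+1)) * (p%:R ^+ k.+1 / k.+2%:R)).
  by rewrite [p%:R ^+ k.+2]exprS; ring.
have lt_kn := ltn_ord k.
rewrite rpredM ?rpred_nat // rpredM //; first by apply: IHm; lia.
rewrite local_int_expn_div // logn_leq_expn //.
exact: ltn_expl (prime_gt1 p_pr).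
Qed.

(* The term of index [k = 0] in the power sum formula is [p * bernoulli n]; only
   [p = 2], [k = 1] leaves a denominator, which an even [n] absorbs. *)
Lemma bernoulli_local_power_sum (p n : nat) :
  prime p -> odd p || ~~ odd n ->
  bernoulli n - (\sum_(a < p) a ^ n)%N%:R / p%:R \in local_int p.
Proof.
move=> p_pr even_pn.
have p_neq0 : p%:R != 0 :> rat by rewrite pnatr_eq0 -lt0n prime_gt0.
have -> : bernoulli n - (\sum_(a < p) a ^ n)%N%:R / p%:R =
  - \sum_(k < n) (p%:R * bernoulli (n - k.+1)) *
                 ('C(n, k.+1)%:R * (p%:R ^+ k / k.+2%:R)).
  apply: (mulfI p_neq0); rewrite mulrBr bernoulli_power_sum_recl mulrCA mulfV //.
  rewrite mulr1 natr_sum.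
  under [X in _ - X]eq_bigr => a _ do rewrite natrX.
  rewrite addrAC subrr sub0r mulrN mulr_sumr; congr (- _); apply: eq_bigr => k _.
  by rewrite !exprS; ring.
rewrite rpredN rpred_sum // => k _; rewrite rpredM ?mul_prime_bernoulli_local_int //.
(* Here [k] is one less than the index in the power sum formula, so the exceptional term is [k = 0],
   with factor [n / 2]. *)
have [/andP[/eqP p2 /eqP k0]|] := boolP [&& p == 2 & k == 0 :> nat]%N.
  rewrite k0 p2 bin1 expr0 mul1r nat_div_local_int // dvdn2.
  by move: even_pn; rewrite p2.
rewrite negb_and => p3_or_k1; rewrite rpredM ?rpred_nat // local_int_expn_div //.
(* What remains is [k + 2 < p ^ (k + 1)], which fails only for [p = 2] and [k = 0]. *)
rewrite logn_leq_expn //; have := prime_gt1 p_pr.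
have [p2 _|p_neq2 p_gt1] := eqVneq p 2%N.
  move: p3_or_k1; rewrite p2 /=; case: (nat_of_ord k) => // j _.
  by have := ltn_expl j.+1 (isT : (1 < 2)%N); rewrite !expnS; lia.
have p_gt2 : (2 < p)%N by lia.
elim: (nat_of_ord k) => [|j IHj]; first by rewrite expn1.
by rewrite expnS; nia.
Qed.

(** Expanding [(a + 1) ^ r] reduces this to the congruence for each [bernoulli (s + nu)], available
    in every degree since [p] is odd. *)
Lemma bernoulli_sum_local_power_sum (p r s : nat) :
  prime p -> odd p ->
  bernoulli_sum r s - (\sum_(a < p) a ^ s * a.+1 ^ r)%N%:R / p%:R
    \in local_int p.
Proof.
move=> p_pr odd_p.
have -> : (\sum_(a < p) a ^ s * a.+1 ^ r)%N%:R / p%:R =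
    \sum_(nu < r.+1) 'C(r, nu)%:R * ((\sum_(a < p) a ^ (s + nu))%N%:R / p%:R)
    :> rat.
  under [RHS]eq_bigr => nu _ do rewrite mulrA -natrM big_distrr /=.
  rewrite -mulr_suml -natr_sum exchange_big /=; congr (_%:R / _).
  apply: eq_bigr => a _; rewrite -add1n expnDn big_distrr /=.
  by apply: eq_bigr => nu _; rewrite exp1n mul1n expnD; lia.
rewrite /bernoulli_sum -sumrB rpred_sum // => nu _.
by rewrite -mulrBr rpredM ?rpred_nat // bernoulli_local_power_sum ?odd_p.
Qed.

(** The power sum uses [0 ^ 0 = 1], so for [s = 0] the index [a = 0] contributes 1. *)
Lemma odd_prime_dvd_denom (p r s : nat) :
  prime p -> odd p ->
  (p %| denom_bernoulli_sum r s)%N = ~~ (p %| \sum_(a < p) a ^ s * a.+1 ^ r)%N.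
Proof.
move=> p_pr odd_p; rewrite /denom_bernoulli_sum local_intN_dvd //.
rewrite -nat_div_local_int //; congr negb.
by rewrite -[bernoulli_sum r s](subrK ((\sum_(a < p) a ^ s * a.+1 ^ r)%N%:R / p%:R))
           rpredDl ?bernoulli_sum_local_power_sum.
Qed.

Lemma mul_prime_bernoulli_sum_local_int (p r s : nat) :
  prime p -> p%:R * bernoulli_sum r s \in local_int p.
Proof.
move=> p_pr; rewrite mulr_sumr rpred_sum // => nu _.
by rewrite mulrCA rpredM ?rpred_nat ?mul_prime_bernoulli_local_int.
Qed.

(** If [p ^ 2] divided [denom q], it would divide [d * p] with [d] the denominator of [p * q],
    forcing [p] to divide [d]. *)
Lemma squarefree_denom (q : rat) :
  (forall p : nat, prime p -> p%:R * q \in local_int p) -> squarefree (denom q).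
Proof.
move=> local_q m m2_dvd; apply/eqP; apply: contraT => m_neq1.
have m_gt0 : (0 < m)%N.
  by case: m m2_dvd {m_neq1} => //; rewrite dvd0n (gtn_eqF (denom_gt0 q)).
have [p p_pr p_dvd] : {p | prime p & (p %| m)%N} by apply: pdivP; lia.
have p2_dvd := dvdn_trans (dvdn_exp2r 2 p_dvd) m2_dvd.
have := local_q p p_pr; rewrite inE; set d := denom (_ * q) => cop.
have : (denom q %| d * p)%N.
  by apply: denom_dvd; rewrite natrM -mulrA denom_mul_int.
move/(dvdn_trans p2_dvd); rewrite expnS expn1 dvdn_pmul2r ?prime_gt0 //.
by rewrite (prime_coprime _ p_pr) in cop; rewrite (negbTE cop).
Qed.

(* Modulo the 2-integers, [bernoulli n] is [(1 + (-1) ^ n) / 4] for [n >= 2], so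
   the sum is [(2 ^ r + (-1) ^ s * (1 - 1) ^ r) / 4]. *)
Lemma bernoulli_sum_local_int2 (r s : nat) :
  (2 <= r)%N -> (2 <= s)%N -> bernoulli_sum r s \in local_int 2.
Proof.
move=> r_ge2 s_ge2.
have bernoulli_mod n : (2 <= n)%N -> bernoulli n - (1 + (-1) ^+ n) / 4 \in local_int 2.
  move=> n_ge2; rewrite -signr_odd; case: (boolP (odd n)) => [odd_n|even_n].
    by rewrite bernoulli_odd // subrr mul0r subr0 rpred0.
  have := bernoulli_local_power_sum 2 n isT even_n.
  rewrite 2!big_ord_recr big_ord0 /= exp0n ?exp1n; last by lia.
  by have -> : (1 + 1) / 4 = 1 / 2 :> rat by [].
have sum_even : \sum_(nu < r.+1) 'C(r, nu)%:R * (1 + (-1) ^+ (s + nu)) = 2 ^+ r :> rat.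
  under eq_bigr => nu _ do rewrite mulrDr mulr1 exprD mulrCA.
  rewrite big_split -mulr_sumr /=.
  have -> : \sum_(nu < r.+1) 'C(r, nu)%:R * (-1) ^+ nu = (1 - 1) ^+ r :> rat.
    by rewrite exprDn; apply: eq_bigr => nu _; rewrite expr1n mul1r mulr_natl.
  rewrite subrr expr0n gtn_eqF 1?ltnW // mulr0 addr0 -[2]/(1 + 1) exprDn.
  by apply: eq_bigr => nu _; rewrite !expr1n mulr1.
have -> : bernoulli_sum r s =
    \sum_(nu < r.+1) 'C(r, nu)%:R *
      (bernoulli (s + nu) - (1 + (-1) ^+ (s + nu)) / 4) + 2 ^+ r / 4.
  rewrite -sum_even mulr_suml -big_split; apply: eq_bigr => nu _ /=.
  by rewrite -mulrA -mulrDr subrK.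
rewrite rpredD ?rpred_sum // => [nu _|].
  by rewrite rpredM ?rpred_nat // bernoulli_mod // ltn_addr.
(* The bound [2 <= r] serves as [logn 2 4 <= r]. *)
exact: (local_int_expn_div 2 r 4).
Qed.

End LocalIntegers.

(** * Power sums modulo a prime *)

Section PowerSums.

Import GRing.Theory.

(** Otherwise, with [t > 0] the remainder of [s] modulo [#|F| - 1], all [#|F| - 1] nonzero elements
    would be roots of [X ^ t - 1], which has at most [t]. *)
Lemma finField_expr_neq1 (F : finFieldType) (s : nat) :
  ~~ (#|F|.-1 %| s) -> exists2 g : F, g != 0%R & (g ^+ s != 1)%R.
Proof.
move=> ndvd; have [/existsP[g /andP[]]|/existsPn all1] :=
  boolP [exists g : F, (g != 0)%R && (g ^+ s != 1)%R]; first by exists g.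
have t_gt0 : 0 < s %% #|F|.-1 by rewrite lt0n.
have cardF1_gt0 : 0 < #|F|.-1 by rewrite -subn1 subn_gt0 finNzRing_gt1.
have := max_unity_roots t_gt0 (rs := enum (predC1 (0%R : F))).
rewrite enum_uniq -cardE cardC1 leqNgt ltn_pmod // => E.
suff /E/(_ isT) : all (s %% #|F|.-1).-unity_root%R (enum (predC1 (0%R : F))) by [].
apply/allP => x; rewrite mem_enum inE => x_neq0; apply/unity_rootP.
have x1 : (x ^+ #|F|.-1 = 1)%R.
  by apply: (mulfI x_neq0); rewrite -exprS prednK ?mulr1 ?expf_card // ltnW ?finNzRing_gt1.
have := all1 x; rewrite x_neq0 /= negbK {1}(divn_eq s #|F|.-1).
by rewrite exprD mulnC exprM x1 expr1n mul1r => /eqP.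
Qed.

(** Multiplication by a suitable [g] permutes [F] and scales the sum by [g ^ s], which is not 1. *)
Lemma finField_power_sum_eq0 (F : finFieldType) (s : nat) :
  ~~ (#|F|.-1 %| s) -> (\sum_(x : F) x ^+ s = 0)%R.
Proof.
move=> /finField_expr_neq1[g g_neq0 gs_neq1].
apply/eqP; apply: contraNT gs_neq1 => S_neq0; apply/eqP/(mulIf S_neq0).
rewrite mul1r [RHS](reindex_inj (mulfI g_neq0)) mulr_sumr.
by apply: eq_bigr => x _; rewrite exprMn.
Qed.

Lemma dvdn_power_sum (p s : nat) :
  prime p -> ~~ (p.-1 %| s) -> p %| \sum_(a < p) a ^ s.
Proof.
move=> p_pr ndvd; rewrite (dvdn_pcharf (pchar_Fp p_pr)) natr_sum.
have := @finField_power_sum_eq0 'F_p s; rewrite card_Fp // => /(_ ndvd) S0.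
rewrite -[X in _ == X]S0 -(big_mkord xpredT (fun a => (a ^ s)%:R%R)).
rewrite -[X in index_iota 0 X](Fp_cast p_pr) big_mkord.
by apply/eqP; apply: eq_bigr => x _; rewrite natrX natr_Zp.
Qed.

Lemma Fermat_mod (p a r : nat) :
  prime p -> ~~ (p %| a) -> p.-1 %| r -> a ^ r = 1 %[mod p].
Proof.
move=> p_pr ndvd /dvdnP[m ->]; rewrite mulnC expnM -modnXm -totient_prime //.
by rewrite Euler_exp_totient ?modnXm ?exp1n // coprime_sym prime_coprime.
Qed.

(** The last term carries [p ^ r] and vanishes; in the others [(a + 1) ^ r] is 1 by Fermat. *)
Lemma shifted_power_sum_mod (p r s : nat) :
  prime p -> 0 < r -> p.-1 %| r ->
  \sum_(a < p) a ^ s * a.+1 ^ r = \sum_(a < p.-1) a ^ s %[mod p].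
Proof.
move=> p_pr r_gt0 dvd_r; rewrite -[in LHS](prednK (prime_gt0 p_pr)) big_ord_recr /=.
rewrite prednK ?prime_gt0 // -modnDmr -[r in _ * p ^ r](prednK r_gt0) expnS.
rewrite mulnCA modnMr addn0 -modn_summ -[RHS]modn_summ; congr (_ %% p).
apply: eq_bigr => a _; have lt_a := ltn_ord a.
rewrite -modnMmr Fermat_mod ?modnMmr ?muln1 // gtnNdvd //.
by have := prime_gt0 p_pr; lia.
Qed.

(** Modulo [p] the sum is [-(p - 1) ^ s] if [p - 1] does not divide [s], [p - 1] if [s = 0], and
    [p - 2] otherwise; none is zero as [p > 2]. *)
Lemma shifted_power_sum_ndvd (p r s : nat) :
  prime p -> 2 < p -> 0 < r -> p.-1 %| r ->
  ~~ (p %| \sum_(a < p) a ^ s * a.+1 ^ r).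
Proof.
move=> p_pr p_gt2 r_gt0 dvd_r; have p_gt0 := prime_gt0 p_pr.
rewrite /dvdn shifted_power_sum_mod // -/(dvdn p _).
have [dvd_s|ndvd_s] := boolP (p.-1 %| s); last first.
  have := dvdn_power_sum p s p_pr ndvd_s.
  have -> : \sum_(a < p) a ^ s = \sum_(a < p.-1) a ^ s + p.-1 ^ s.
    by case: (p) p_gt0 => // q _; rewrite big_ord_recr.
  move=> dvd_sum; apply/negP => dvd_p.
  by move: dvd_sum; rewrite dvdn_addr // Euclid_dvdX // gtnNdvd; lia.
have [->|s_gt0] := posnP s.
  by under eq_bigr do rewrite expn0; rewrite sum1_card card_ord gtnNdvd; lia.
have -> : p.-1 = p.-2.+1 by lia.
rewrite big_ord_recl exp0n // add0n /dvdn -modn_summ.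
rewrite (eq_bigr (fun=> 1)) => [|a _].
  by rewrite sum1_card card_ord modn_small; lia.
have lt_a := ltn_ord a; have ndvd_a : ~~ (p %| a.+1) by rewrite gtnNdvd; lia.
by rewrite lift0 (Fermat_mod _ _ _ p_pr ndvd_a dvd_s) modn_small //; lia.
Qed.

End PowerSums.

(** * Arithmetic of the denominators *)

Theorem theorem4p1 (r s : nat) :
  (denom_bernoulli_sum r s = denom_bernoulli_sum s r)
  /\ (denom_bernoulli_sum 0 s = denom_bernoulli s)
  /\ ((s = 0 -> denom_bernoulli_sum 1 s = 2)
      /\ (s = 1 -> denom_bernoulli_sum 1 s = 3)
      /\ (2 <= s -> ~~ odd s -> denom_bernoulli_sum 1 s = denom_bernoulli s)
      /\ (3 <= s -> odd s -> denom_bernoulli_sum 1 s = denom_bernoulli s.+1))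
  /\ (2 <= r -> 2 <= s -> ~~ (2 %| denom_bernoulli_sum r s))
  /\ (1 <= r -> 1 <= s -> 3 %| denom_bernoulli_sum r s)
  /\ (2 <= r -> ~~ odd r ->
      forall p : nat, prime p -> 3 <= p -> p.-1 %| r ->
      p %| denom_bernoulli_sum r s)
  /\ squarefree (denom_bernoulli_sum r s)
  /\ (denom_bernoulli_sum r s = 1 <->
      [\/ r = 0 /\ s = 0,
          [/\ 3 <= r, odd r & s = 0] |
          [/\ r = 0, 3 <= s & odd s]]).
Proof.
have symm t u : denom_bernoulli_sum t u = denom_bernoulli_sum u t.
  rewrite /denom_bernoulli_sum bernoulli_sumC -GRing.signr_odd.
  by case: odd; rewrite ?GRing.mul1r // GRing.mulN1r /denom denqN.
have sum0 u : denom_bernoulli_sum 0 u = denom_bernoulli u.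
  by rewrite /denom_bernoulli_sum /bernoulli_sum big_ord1 addn0 GRing.mul1r.
have sum1 u : bernoulli_sum 1 u = (bernoulli u + bernoulli u.+1)%R.
  by rewrite /bernoulli_sum !big_ord_recr big_ord0 /= addn0 addn1 !bin0 bin1
             GRing.add0r !GRing.mul1r.
have denom10 : denom_bernoulli_sum 1 0 = 2.
  by rewrite /denom_bernoulli_sum sum1 bernoulli0 bernoulli1.
(* Modulo 3 only [a = 1] contributes to the power sum, with the value [2 ^ t]. *)
have dvd3 t u : 0 < t -> 0 < u -> 3 %| denom_bernoulli_sum t u.
  move=> t_gt0 u_gt0; rewrite odd_prime_dvd_denom // !big_ord_recr big_ord0 /=.
  rewrite exp0n // !exp1n !mul1n.
  by rewrite dvdn_addl ?dvdn_mull ?Euclid_dvdX ?dvdn_exp // Euclid_dvdX.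
have dvdp t u p : 0 < t -> prime p -> 2 < p -> p.-1 %| t ->
    p %| denom_bernoulli_sum t u.
  move=> t_gt0 p_pr p_gt2 dvd_t; rewrite odd_prime_dvd_denom //.
    exact: shifted_power_sum_ndvd.
  by case: (even_prime p_pr) p_gt2 => [->|].
have odd1 t : 3 <= t -> odd t -> denom_bernoulli_sum 0 t = 1.
  by move=> t_ge3 odd_t; rewrite sum0 /denom_bernoulli bernoulli_odd // ltnW.
(* An even [t] is a multiple of [3 - 1], so 3 divides the denominator; for [t = 1] the denominator
   is 2. *)
have not1 t : 0 < t -> denom_bernoulli_sum t 0 = 1 -> 3 <= t /\ odd t.
  move=> t_gt0 d1; have odd_t : odd t.
    apply: contraT => even_t; have := dvdp t 0 3 t_gt0 isT isT.
    by rewrite dvdn2 even_t d1 => /(_ isT).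
  by case: t odd_t d1 {t_gt0} => [|[|[|t]]] //; rewrite denom10.
do !split => //.
- by move->.
- by move->; rewrite /denom_bernoulli_sum sum1 bernoulli1 bernoulli2.
- move=> s_ge2 even_s; rewrite /denom_bernoulli_sum sum1.
  by rewrite (bernoulli_odd s.+1) ?GRing.addr0 // ltnW.
- move=> s_ge3 odd_s; rewrite /denom_bernoulli_sum sum1.
  by rewrite (bernoulli_odd s) ?GRing.add0r // ltnW.
- by move=> r_ge2 s_ge2; rewrite local_intN_dvd // negbK bernoulli_sum_local_int2.
- exact: dvd3.
- by move=> r_ge2 _ p; apply: dvdp; apply: ltnW.
- by apply: squarefree_denom => p; apply: mul_prime_bernoulli_sum_local_int.
(* When both indices are positive, divisibility by 3 excludes the denominator 1. *)
- have [->|r_gt0] := posnP r; have [->|s_gt0] := posnP s.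
  + by move=> _; apply: Or31.
  + by rewrite symm => /(not1 _ s_gt0)[s_ge3 odd_s]; apply: Or33.
  + by move=> /(not1 _ r_gt0)[r_ge3 odd_r]; apply: Or32.
  by move=> d1; have := dvd3 r s r_gt0 s_gt0; rewrite d1.
- case=> [[-> ->]|[r_ge3 odd_r ->]|[-> s_ge3 odd_s]]; last exact: odd1.
    by rewrite sum0 /denom_bernoulli bernoulli0.
  by rewrite symm odd1.
Qed.
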